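(* Let $\mathcal S_{Sb}$ be the set of strong-Baxter permutations, $\mathcal W_{Sb}$ the set of two-dimensional walks in $\mathbb Z_{\ge0}^2$ started at $(0,0)$ with increments in $I_{Sb}=\{(-i,0):i\ge1\}\cup\{(0,1)\}\cup\{(1,-i):i\ge0\}$, and $\mathcal C_{Sb}=\mathrm{WC}_{Sb}(\mathcal W_{Sb})$. The diagram formed by the maps $$\mathrm{PW}:\mathcal S_{Sb}\to\mathcal W_{Sb},\qquad \mathrm{WC}_{Sb}:\mathcal W_{Sb}\to\mathcal C_{Sb},\qquad \mathrm{CP}:\mathcal C_{Sb}\to\mathcal S_{Sb}$$ commutes, that is, $\mathrm{PW}^{-1}=\mathrm{CP}\circ\mathrm{WC}_{Sb}$ on $\mathcal W_{Sb}$.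
   Context: Strong-Baxter permutations: a permutation $\sigma$ of $[n]=\{1,\dots,n\}$ is strong-Baxter if there are no indices $1\le i<j<k-1<n$ such that $\sigma(j+1)<\sigma(i)<\sigma(k)<\sigma(j)$, or $\sigma(j)<\sigma(k)<\sigma(i)<\sigma(j+1)$, or $\sigma(j+1)<\sigma(k)<\sigma(i)<\sigma(j)$. Active sites: for a permutation $\sigma$ of size $n$ and $m\in[n+1]$, $\sigma^{*m}$ is the permutation of size $n+1$ obtained by appending a new final value $m$ and shifting by $+1$ all the values $\ge m$. For $\sigma\in\mathcal S_{Sb}$, $m$ is an active site of $\sigma$ if $\sigma^{*m}\in\mathcal S_{Sb}$; $\mathrm{AS}(\sigma)$ is the set of active sites. The label of $\sigma\in\mathcal S_{Sb}$ of size $n$ is $\big(\#\{m\in\mathrm{AS}(\sigma):m\le\sigma(n)\}-1,\ \#\{m\in\mathrm{AS}(\sigma):m>\sigma(n)\}-1\big)\in\mathbb Z_{\ge0}^2$. The map $\mathrm{PW}$: for $\sigma\in\mathcal S_{Sb}$ of size $n$, $\mathrm{PW}(\sigma)=(W_1,\dots,W_n)$ where $W_m$ is the label of the permutation of size $m$ in the same relative order as $\sigma(1),\dots,\sigma(m)$. It is known that $\mathrm{PW}$ is a bijection from $\mathcal S_{Sb}$ onto $\mathcal W_{Sb}$, sending permutations of size $n$ to walks $(W_i)_{i\in[n]}$ with $n$ points. (This comes from the succession rule with root label $(0,0)$, in which $(h,k)$ has children $(0,k),\dots,(h-1,k)$; $(h,k+1)$; $(h+1,0),\dots,(h+1,k)$.)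 The map $\mathrm{WC}_{Sb}$: for a walk $W=(X_t,Y_t)_{t\in I}$ with increments in $I_{Sb}$ indexed by an interval $I\subseteq\mathbb Z$, $\mathrm{WC}_{Sb}(W)=\{Z^{(t)}\}_{t\in I}$, where $Z^{(t)}_t=0$ and for $\ell\ge t$ with $\ell+1\in I$, writing $\Delta X=X_{\ell+1}-X_\ell$, $\Delta Y=Y_{\ell+1}-Y_\ell$, $$Z^{(t)}_{\ell+1}=\begin{cases}Z^{(t)}_\ell+\Delta Y,&\text{if }(Z^{(t)}_\ell=0\text{ and }Z^{(t)}_\ell-\Delta X\ge0)\text{ or }(Z^{(t)}_\ell>0\text{ and }Z^{(t)}_\ell+\Delta Y>0),\\ -1,&\text{if }Z^{(t)}_\ell>0\text{ and }Z^{(t)}_\ell+\Delta Y\le0,\\ Z^{(t)}_\ell-\Delta X,&\text{if }Z^{(t)}_\ell\le0\text{ and }Z^{(t)}_\ell-\Delta X<0,\\ 0,&\text{if }Z^{(t)}_\ell<0\text{ and }Z^{(t)}_\ell-\Delta X\ge0.\end{cases}$$ The map $\mathrm{CP}$: for such a family $Z=\{Z^{(t)}\}_{t\in[n]}$ define the relation $\le_Z$ on $[n]$ by $i\le_Z i$; for $i<j$: $i\le_Z j$ if $Z^{(i)}_j\le0$, and $j\le_Z i$ if $Z^{(i)}_j>0$. This is a total order, and $\mathrm{CP}(Z)$ is the unique permutation $\sigma$ of $[n]$ such that $\sigma(i)\le\sigma(j)\iff i\le_Z j$ for all $i,j\in[n]$; consequently $\sigma(j)=\#\{i\in[j]:Z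^{(i)}_j\le0\}+\#\{i\in[j+1,n]:Z^{(j)}_i>0\}$.
   Formalization: The order is taken, for i<j, as i ≤_Z j if Z^{(i)}_j < 0 and j ≤_Z i if Z^{(i)}_j ≥ 0 (instead of ≤ 0 and > 0); with the stated convention the walks (0,0),(1,0),(2,0) and (0,0),(1,0),(0,0) would both give 123. *)

(* Defs.v *)
From mathcomp Require Import all_boot all_order all_fingroup all_algebra.

Set Implicit Arguments.
Unset Strict Implicit.
Unset Printing Implicit Defensive.

Import Order.TTheory GRing.Theory Num.Theory.

(* Positions, values and times in [n] = {1, ..., n} are represented by 'I_n,
   so everything is shifted down by one. *)

Definition strong_Baxter (n : nat) (s : 'S_n) : bool :=
  [forall i : 'I_n, forall j : 'I_n, forall j1 : 'I_n, forall k : 'I_n,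
    [&& i < j, j1 == j.+1 :> nat & j1 < k] ==>
      ~~ [|| [&& s j1 < s i, s i < s k & s k < s j],
             [&& s j < s k, s k < s i & s i < s j1] |
             [&& s j1 < s k, s k < s i & s i < s j]]].

(* The permutation sigma^{*m}: [lift m] increments exactly the values >= m. *)
Definition append_value (n : nat) (s : 'S_n) (m : 'I_n.+1) : 'S_n.+1 :=
  lift_perm ord_max m s.

Definition active_sites (n : nat) (s : 'S_n) : {set 'I_n.+1} :=
  [set m | strong_Baxter (append_value s m)].

(* The subtraction is performed in int, hence is not truncated. *)
Definition label (n : nat) (s : 'S_n.+1) : int * int :=
  ((#|[set m in active_sites s | (m <= s ord_max)%N]|%:Z - 1)%R,
   (#|[set m in active_sites s | (s ord_max < m)%N]|%:Z - 1)%R).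

Section Pattern.
Variables (n m : nat) (le_mn : m <= n) (s : 'S_n).

Definition pattern_rank (i : 'I_m) : nat :=
  #|[set j : 'I_m | s (widen_ord le_mn j) < s (widen_ord le_mn i)]|.

Lemma pattern_rank_lt (i : 'I_m) : pattern_rank i < m.
Proof.
rewrite -[X in _ < X]card_ord -cardsT; apply: proper_card.
by apply/properP; split; [apply: subsetT | exists i; rewrite !inE ?ltnn].
Qed.

Lemma pattern_rank_homo (i j : 'I_m) :
  s (widen_ord le_mn i) < s (widen_ord le_mn j) ->
  pattern_rank i < pattern_rank j.
Proof.
move=> ltij; apply: proper_card; apply/properP; split.
  by apply/subsetP=> k; rewrite !inE => /ltn_trans; apply.
by exists i; rewrite !inE ?ltnn.
Qed.

Lemma pattern_rank_inj : injective (fun i => Ordinal (pattern_rank_lt i)).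
Proof.
move=> i j [] eqr.
have nlt a b : pattern_rank a = pattern_rank b ->
    s (widen_ord le_mn b) <= s (widen_ord le_mn a).
  move=> e; rewrite leqNgt; apply/negP => /pattern_rank_homo.
  by rewrite e ltnn.
have /val_inj/perm_inj/(congr1 val)/= eqij :
    s (widen_ord le_mn i) = s (widen_ord le_mn j) :> nat.
  by apply/eqP; rewrite eqn_leq !nlt.
exact: val_inj.
Qed.

(* The permutation of size m in the same relative order as the first m
   values of s. *)
Definition prefix_pattern : 'S_m := perm pattern_rank_inj.

End Pattern.

Definition PW (n : nat) (s : 'S_n) : n.-tuple (int * int) :=
  [tuple label (prefix_pattern (ltn_ord m) s) | m < n].

Local Open Scope ring_scope.

Definition I_Sb (d : int * int) : Prop :=
  [\/ exists2 i : nat, (1 <= i)%N & d = (- i%:Z, 0),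
      d = (0, 1) |
      exists i : nat, d = (1, - i%:Z)].

Definition W_Sb (n : nat) (W : n.+1.-tuple (int * int)) : Prop :=
  [/\ W`_0 = (0, 0),
      forall t : nat, (t < n.+1)%N -> 0 <= (W`_t).1 /\ 0 <= (W`_t).2 &
      forall t : nat, (t.+1 < n.+1)%N -> I_Sb (W`_t.+1 - W`_t)].

(* One step of a coalescent walk at height z, for the increment (dX, dY). *)
Definition coalescent_step (z dX dY : int) : int :=
  if ((z == 0) && (0 <= z - dX)) || ((0 < z) && (0 < z + dY)) then z + dY
  else if (0 < z) && (z + dY <= 0) then -1
  else if (z <= 0) && (z - dX < 0) then z - dX
  else 0.

(* [coalescent_walk W t k] is the height at time t + k of the walk started
   from 0 at time t. *)
Fixpoint coalescent_walk (W : seq (int * int)) (t k : nat) : int :=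
  if k is k'.+1 then
    let d := W`_(t + k').+1 - W`_(t + k') in
    coalescent_step (coalescent_walk W t k') d.1 d.2
  else 0.

(* [WC_Sb W t l] is Z^{(t)}_l; only the values with t <= l are meaningful. *)
Definition WC_Sb (n : nat) (W : n.-tuple (int * int)) (t l : 'I_n) : int :=
  coalescent_walk W t (l - t).

(* A point at height exactly 0 at a later time lies above the current point:
   i <=_Z j (for i < j) when Z^{(i)}_j < 0, and j <=_Z i when Z^{(i)}_j >= 0.
   Counting 0 on the other side makes CP \o WC_Sb non-injective: the walks
   (0,0),(1,0),(2,0) and (0,0),(1,0),(0,0), which are the images under PW of
   123 and 231, would both be sent to 123. *)
Definition le_Z (n : nat) (Z : 'I_n -> 'I_n -> int) (i j : 'I_n) : bool :=
  if (i < j)%N then Z i j < 0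
  else if (j < i)%N then 0 <= Z j i
  else true.

(* None when le_Z is not a total order. *)
Definition CP (n : nat) (Z : 'I_n -> 'I_n -> int) : option 'S_n :=
  [pick s : 'S_n | [forall i, forall j, (s i <= s j)%N == le_Z Z i j]].

(* Main.v *)
(* Every permutation arises by appending final values. For a strong-Baxter [s]
   let A x be the number of active sites that are at most x. Appending a value
   [m] splits the site [m] in two and, if some value lies between the old and
   the new last value, blocks the sites between them (except, for an ascent, the
   one just below the new value), so A changes in an explicit way. The label is (A v - 1, A (max) - A v - 1), where v is the last
   value, and the recursion yields the increments of I_Sb, the cases m < v,
   m = v and m > v corresponding to its three families; since A grows by steps
   of at most one, every admissible increment is attained. The same recursion
   shows that the coalescent walk started at t has height A (s t) - A v at the
   final time: the four clauses of its definition are the effects of an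
   insertion on this difference. As v is itself an active site, the height is
   negative exactly when s t < v, so the coalescent walks recover the order. *)
Require Import Defs.
From mathcomp Require Import all_boot all_order all_fingroup all_algebra.
From mathcomp Require Import zify.

Set Implicit Arguments.
Unset Strict Implicit.
Unset Printing Implicit Defensive.

Import Order.TTheory GRing.Theory Num.Theory.

(** * Relative order, prefix patterns and appended values *)

Lemma perm_rank (n : nat) (s : 'S_n) (i : 'I_n) :
  s i = #|[set j | s j < s i]| :> nat.
Proof.
have -> : [set j | s j < s i] = s @^-1: [set j : 'I_n | j < s i].
  by apply/setP=> j; rewrite !inE.
rewrite on_card_preimset; last first.
  by apply/onW_bij; exists s^-1%g; [apply: permK | apply: permKV].
rewrite cardsE cardE /enum_mem size_filter -enumT.
have -> : count [in fun j : 'I_n => j < s i] (enum 'I_n)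
   = count (fun x => x < s i) (map val (enum 'I_n)) by rewrite count_map.
rewrite val_enum_ord -[n in iota 0 n](subnKC (ltnW (ltn_ord (s i)))) iotaD.
rewrite count_cat (eq_in_count (a2 := predT)) ?count_predT ?size_iota; last first.
  by move=> x; rewrite mem_iota add0n.
rewrite (eq_in_count (a2 := pred0)) ?count_pred0 ?addn0 //.
by move=> x; rewrite mem_iota /= => H; apply/negP; lia.
Qed.

Lemma perm_order_inj (n : nat) (p q : 'S_n) :
  (forall i j, (p i < p j) = (q i < q j)) -> p = q.
Proof.
move=> h; apply/permP=> i; apply: val_inj; rewrite /= (perm_rank p) (perm_rank q).
by apply: eq_card => j; rewrite !inE h.
Qed.

Lemma perm_val_eq (n : nat) (s : 'S_n) (i j : 'I_n) :
  (s i == s j :> nat) = (i == j :> nat).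
Proof. by apply/eqP/eqP => [/val_inj/perm_inj -> // | /val_inj ->]. Qed.

Lemma prefix_pattern_lt (n m : nat) (le_mn : m <= n) (s : 'S_n) (i j : 'I_m) :
  (prefix_pattern le_mn s i < prefix_pattern le_mn s j) =
  (s (widen_ord le_mn i) < s (widen_ord le_mn j)).
Proof.
rewrite !permE /=; case: (ltngtP (s (widen_ord le_mn i))) => [|h|h].
- exact: pattern_rank_homo.
- by apply/negbTE; rewrite -leqNgt ltnW //; apply: pattern_rank_homo.
- have /val_inj -> : i = j :> nat.
    by apply/eqP; rewrite -[_ == _](perm_val_eq s (widen_ord le_mn i) (widen_ord le_mn j)) h.
  by rewrite ltnn.
Qed.

Lemma append_value_last (n : nat) (s : 'S_n) (m : 'I_n.+1) :
  append_value s m ord_max = m.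
Proof. exact: lift_perm_id. Qed.

Lemma append_value_lift (n : nat) (s : 'S_n) (m : 'I_n.+1) (i : 'I_n) :
  append_value s m (lift ord_max i) = bump m (s i) :> nat.
Proof. by rewrite /append_value lift_perm_lift. Qed.

Lemma prefix_append (n k : nat) (le_k : k <= n) (le_k' : k <= n.+1) (s : 'S_n)
    (m : 'I_n.+1) :
  prefix_pattern le_k' (append_value s m) = prefix_pattern le_k s.
Proof.
apply: perm_order_inj => i j; rewrite !prefix_pattern_lt.
have w (a : 'I_k) : widen_ord le_k' a = lift ord_max (widen_ord le_k a).
  by apply: val_inj; rewrite /= /bump leqNgt (leq_trans (ltn_ord a) le_k).
by rewrite !w !append_value_lift /bump; lia.
Qed.

Lemma prefix_pattern_full (n : nat) (le_nn : n <= n) (s : 'S_n) :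
  prefix_pattern le_nn s = s.
Proof.
apply: perm_order_inj => i j; rewrite prefix_pattern_lt.
by congr (s _ < s _); apply: val_inj.
Qed.

(** This opens every induction on the size. Values are compared as ranks: the last position adds one
    to the rank of exactly the values above the last one, which is what [bump] does. *)
Lemma append_prefix (n : nat) (s : 'S_n.+1) :
  s = append_value (prefix_pattern (leqnSn n) s) (s ord_max).
Proof.
have val_s (i : 'I_n) : s (lift ord_max i)
    = bump (s ord_max) (prefix_pattern (leqnSn n) s i) :> nat.
  have w (a : 'I_n) : widen_ord (leqnSn n) a = lift ord_max a.
    by apply: val_inj; rewrite /= /bump leqNgt ltn_ord.
  rewrite [LHS]perm_rank [prefix_pattern _ _ i : nat]perm_rank.
  set B := [set j | _]; set C := [set j | _].
  have eB : B = [set lift ord_max j | j in C]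
               :|: (if s ord_max < s (lift ord_max i) then [set ord_max] else set0).
    apply/setP => j; rewrite !inE; case: (unliftP ord_max j) => [k|] ->.
      rewrite mem_imset; last exact: lift_inj.
      rewrite inE prefix_pattern_lt !w; case: ifP => _; rewrite ?inE ?orbF //.
      by rewrite [_ == ord_max]eq_sym (negbTE (neq_lift _ _)) orbF.
    case: ifP => _; rewrite ?inE ?eqxx ?orbT // orbF.
    apply/esym/negbTE/negP => /imsetP[k _ /eqP]; exact/negP/neq_lift.
  have card_im : #|[set lift ord_max j | j in C]| = #|C|.
    by apply: card_imset; apply: lift_inj.
  have s_ne : (s ord_max == s (lift ord_max i) :> nat) = false.
    by rewrite perm_val_eq; exact/negbTE/neq_lift.
  have cB : #|B| = (s ord_max < s (lift ord_max i)) + #|C|.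
    rewrite eB; case: ifP => h; last by rewrite setU0 card_im.
    rewrite setUC cardsU1 card_im; congr (_ + _); apply/eqP; rewrite eqb1.
    apply/negP => /imsetP[k _ /eqP]; exact/negP/neq_lift.
  have := cB; rewrite -perm_rank /bump; lia.
apply/permP => i; apply: val_inj; case: (unliftP ord_max i) => [k|] ->.
  by rewrite /= append_value_lift -val_s.
by rewrite append_value_last.
Qed.

(** * Sites blocked by a forbidden pattern *)

(* The site [x] is the gap just below the value [x], so a value [a] lies above it
   when [x <= a]. *)
Definition barred (a b b1 x : nat) : bool :=
  [|| [&& b1 < a, a < x & x <= b], [&& b < x, x <= a & a < b1] |
      [&& b1 < x, x <= a & a < b]].

Definition free_site (n : nat) (s : 'S_n) (x : nat) : bool :=
  [forall i : 'I_n, forall j : 'I_n, forall j1 : 'I_n,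
    (i < j) && (j1 == j.+1 :> nat) ==> ~~ barred (s i) (s j) (s j1) x].

Lemma free_siteP (n : nat) (s : 'S_n) (x : nat) :
  reflect (forall i j j1 : 'I_n, i < j -> j1 = j.+1 :> nat ->
             ~~ barred (s i) (s j) (s j1) x)
          (free_site s x).
Proof.
apply: (iffP idP) => [/forallP h i j j1 lt_ij /eqP ej | h].
  by have /forallP/(_ j)/forallP/(_ j1)/implyP := h i; rewrite lt_ij ej; apply.
apply/forallP => i; apply/forallP => j; apply/forallP => j1.
by apply/implyP => /andP[lt_ij /eqP]; apply: h.
Qed.

(** At distinct positions the values differ, so the weak inequalities of [barred] become strict at
    [x = s k]. One predicate thus serves both for patterns and for sites. *)
Lemma strong_BaxterP (n : nat) (s : 'S_n) :
  reflect (forall i j j1 k : 'I_n, i < j -> j1 = j.+1 :> nat -> j1 < k ->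
             ~~ barred (s i) (s j) (s j1) (s k))
          (strong_Baxter s).
Proof.
have E (i j j1 k : 'I_n) : i < j -> j1 = j.+1 :> nat -> j1 < k ->
    barred (s i) (s j) (s j1) (s k) =
    [|| [&& s j1 < s i, s i < s k & s k < s j],
        [&& s j < s k, s k < s i & s i < s j1] |
        [&& s j1 < s k, s k < s i & s i < s j]].
  move=> lt_ij ej lt_jk; rewrite /barred.
  have := perm_val_eq s k i; have := perm_val_eq s k j; lia.
apply: (iffP idP) => [/forallP h i j j1 k lt_ij ej lt_jk | h].
  have /forallP/(_ j)/forallP/(_ j1)/forallP/(_ k)/implyP := h i.
  by rewrite lt_ij ej eqxx -ej lt_jk E //; apply.
apply/forallP => i; apply/forallP => j; apply/forallP => j1; apply/forallP => k.
apply/implyP => /and3P[lt_ij /eqP ej lt_jk]; rewrite -E //; exact: h.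
Qed.

(** In a forbidden pattern of the longer permutation, the last position can only play the role of
    [k], the rightmost index. *)
Lemma strong_Baxter_append (n : nat) (s : 'S_n) (m : 'I_n.+1) :
  strong_Baxter (append_value s m) = strong_Baxter s && free_site s m.
Proof.
apply/strong_BaxterP/andP => [h | [/strong_BaxterP hs /free_siteP hm]].
  split; [apply/strong_BaxterP => i j j1 k | apply/free_siteP => i j j1] => lt_ij ej.
    move=> lt_jk.
    have := h (lift ord_max i) (lift ord_max j) (lift ord_max j1) (lift ord_max k).
    rewrite !lift_max !append_value_lift => /(_ lt_ij ej lt_jk).
    by rewrite /barred /bump; lia.
  have := h (lift ord_max i) (lift ord_max j) (lift ord_max j1) ord_max.
  rewrite !lift_max append_value_last !append_value_lift => /(_ lt_ij ej (ltn_ord _)).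
  by rewrite /barred /bump; lia.
move=> i j j1 k.
case: (unliftP ord_max i) => [i'|] -> lt_ij; last first.
  by have := ltn_ord j; rewrite /= in lt_ij *; lia.
case: (unliftP ord_max j) lt_ij => [j'|] -> lt_ij ej; last first.
  by have := ltn_ord j1; rewrite /= in ej *; lia.
case: (unliftP ord_max j1) ej => [j1'|] -> ej lt_jk; last first.
  by have := ltn_ord k; rewrite /= in lt_jk *; lia.
rewrite !lift_max in lt_ij ej lt_jk.
case: (unliftP ord_max k) lt_jk => [k'|] -> lt_jk.
  rewrite lift_max in lt_jk; have := hs i' j' j1' k' lt_ij ej lt_jk.
  by rewrite !append_value_lift /barred /bump; lia.
have := hm i' j' j1' lt_ij ej.
by rewrite append_value_last !append_value_lift /barred /bump; lia.
Qed.

Lemma free_site_last (n : nat) (s : 'S_n.+1) :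
  strong_Baxter s -> free_site s (s ord_max).
Proof.
move/strong_BaxterP => h; apply/free_siteP => i j j1 lt_ij ej.
case: (ltngtP j1 n) => [lt_j1|gt_j1|e_j1].
- exact: h.
- by have := ltn_ord j1; lia.
- have -> : j1 = ord_max by apply: val_inj.
  by rewrite /barred; lia.
Qed.

Lemma free_site_ge (n : nat) (s : 'S_n) (x : nat) : n <= x -> free_site s x.
Proof.
move=> le_nx; apply/free_siteP => i j j1 _ _; rewrite /barred.
by have := ltn_ord (s i); have := ltn_ord (s j); lia.
Qed.

(* The subtraction undoes the shift of the values above [m]; in particular the
   site [m] of [s] splits into the sites [m] and [m.+1]. *)
Lemma free_site_append (n : nat) (s : 'S_n.+1) (m : 'I_n.+2) (x : nat) :
  x <= n.+2 ->
  free_site (append_value s m) x =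
  free_site s (x - (m < x)) &&
    ~~ ((m < s ord_max) && (m < x <= (s ord_max).+1) ||
        (s ord_max < x) && (x < m)).
Proof.
move=> le_x; set v := s ord_max.
apply/free_siteP/andP => [h | [/free_siteP h hv] i j j1].
  split.
    apply/free_siteP => i j j1 lt_ij ej.
    have := h (lift ord_max i) (lift ord_max j) (lift ord_max j1).
    rewrite !lift_max !append_value_lift => /(_ lt_ij ej).
    by rewrite /barred /bump; lia.
  apply/negP => hx.
  (* The old and new last values form the adjacent pair, and [u] is the earlier value completing the
     pattern. For a descent take [u = m]: the first and third patterns together block all of
     [m < x <= v.+1]. For an ascent take [u = m.-1]: the second pattern blocks [v < x < m]. *)
  have [u [lt_u hu]] : exists u : 'I_n.+1, u != v /\
      (if m < v then m <= u < v else (v < u) && (u.+1 == m)).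
    case: (ltnP m v) => lt_mv.
      have lt_m : m < n.+1 by apply: (leq_trans lt_mv); rewrite ltnW.
      exists (Ordinal lt_m); rewrite -val_eqE /=; lia.
    have lt_m : m.-1 < n.+1 by have := ltn_ord m; lia.
    exists (Ordinal lt_m); rewrite -val_eqE /=; lia.
  have ne_i : (s^-1)%g u != ord_max.
    by apply: contraNneq lt_u => e; rewrite /v -e permKV.
  have lt_i : (s^-1)%g u < n.
    by have := ltn_ord ((s^-1)%g u); rewrite -val_eqE /= in ne_i *; lia.
  have := h (lift ord_max ((s^-1)%g u)) (lift ord_max ord_max) ord_max.
  rewrite !lift_max !append_value_lift append_value_last permKV -/v => /(_ lt_i erefl).
  by move: hu; rewrite /barred /bump; case: ifP; lia.
case: (unliftP ord_max i) => [i'|] -> lt_ij; last first.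
  by have := ltn_ord j; rewrite /= in lt_ij *; lia.
case: (unliftP ord_max j) lt_ij => [j'|] -> lt_ij ej; last first.
  by have := ltn_ord j1; rewrite /= in ej *; lia.
rewrite !lift_max in lt_ij ej.
case: (unliftP ord_max j1) ej => [j1'|] -> ej.
  rewrite lift_max in ej; have := h i' j' j1' lt_ij ej.
  by rewrite !append_value_lift /barred /bump; lia.
have -> : j' = ord_max by apply: val_inj => /=; rewrite /= in ej; lia.
rewrite append_value_last !append_value_lift -/v.
by move: hv; rewrite /barred /bump; lia.
Qed.

(** * The counting function of the free sites *)

Definition site_count (n : nat) (s : 'S_n) (x : nat) : nat :=
  \sum_(0 <= y < x.+1) free_site s y.

Lemma site_count0 (n : nat) (s : 'S_n) : site_count s 0 = free_site s 0.
Proof. by rewrite /site_count big_nat1. Qed.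

Lemma site_countS (n : nat) (s : 'S_n) (x : nat) :
  site_count s x.+1 = site_count s x + free_site s x.+1.
Proof. by rewrite /site_count big_nat_recr. Qed.

Lemma leq_site_count (n : nat) (s : 'S_n) (x y : nat) :
  x <= y -> site_count s x <= site_count s y.
Proof.
elim: y => [|y IH]; first by rewrite leqn0 => /eqP ->.
rewrite leq_eqVlt => /orP[/eqP -> // | /IH]; rewrite site_countS; lia.
Qed.

Lemma ltn_site_count (n : nat) (s : 'S_n) (x y : nat) :
  free_site s y -> x < y -> site_count s x < site_count s y.
Proof.
case: y => // y hy; rewrite ltnS site_countS hy => /(leq_site_count s); lia.
Qed.

Lemma site_count_gt0 (n : nat) (s : 'S_n) (x : nat) :
  free_site s x -> 0 < site_count s x.
Proof. by case: x => [|x] hx; rewrite ?site_count0 ?site_countS hx ?addn1. Qed.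

(** Discrete intermediate values: the count rises by at most one at each site and only at free ones,
    so the site where it first reaches [c] is free. *)
Lemma site_count_ivt (n : nat) (s : 'S_n) (N c : nat) :
  0 < c <= site_count s N ->
  exists x, [/\ x <= N, free_site s x & site_count s x = c].
Proof.
elim: N => [|N IH] hc.
  by exists 0; move: hc; rewrite site_count0; case: (free_site s 0); split; lia.
case: (leqP c (site_count s N)) => [le_c | lt_c].
  have [|x [le_x hx ex]] := IH; first by lia.
  by exists x; split => //; lia.
by exists N.+1; move: hc; rewrite site_countS; case: (free_site s N.+1); split; lia.
Qed.

Lemma label_site_count (n : nat) (s : 'S_n.+1) : strong_Baxter s ->
  label s = ((site_count s (s ord_max))%:Z - 1,
             (site_count s n.+1)%:Z - (site_count s (s ord_max))%:Z - 1)%R.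
Proof.
move=> SBs.
have card_sites (P : pred nat) :
    #|[set m in active_sites s | P m]| = \sum_(m < n.+2 | P m) free_site s m.
  rewrite -sum1_card big_mkcond [RHS]big_mkcond /=; apply: eq_bigr => m _.
  by rewrite !inE strong_Baxter_append SBs /=; case: (free_site s m) (P m) => [] [].
rewrite /label (card_sites (fun m => m <= s ord_max)).
rewrite (card_sites (fun m => s ord_max < m)).
have e1 : \sum_(m < n.+2 | m <= s ord_max) free_site s m = site_count s (s ord_max).
  rewrite /site_count big_mkord (big_ord_widen n.+2 (fun y => free_site s y : nat)) //.
  by rewrite ltnS ltnW.
have e2 : site_count s n.+1 = site_count s (s ord_max) +
    \sum_(m < n.+2 | s ord_max < m) free_site s m.
  rewrite -e1 {1}/site_count big_mkord (bigID (fun m : 'I_n.+2 => m <= s ord_max)) /=.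
  by congr (_ + _); apply: eq_bigl => m; rewrite -ltnNge.
rewrite e1 e2; congr pair; lia.
Qed.

(** * Effect of an appended value on counts, labels and heights *)

Section AppendCount.
Variables (n : nat) (s : 'S_n.+1) (m : 'I_n.+2).
Hypotheses (SBs : strong_Baxter s) (m_free : free_site s m).
Local Notation v := (s ord_max : nat).
Local Notation A := (site_count s).
Local Notation A' := (site_count (append_value s m)).

Lemma site_count_append_le (x : nat) : m <= v -> x <= m -> A' x = A x.
Proof.
move=> le_mv; elim: x => [|x IH] le_x.
  rewrite !site_count0 free_site_append // ltn0 subn0.
  by case: (free_site s 0) => //=; lia.
rewrite !site_countS IH ?(ltnW le_x) // free_site_append; last by have := ltn_ord m; lia.
have -> : x.+1 - (m < x.+1) = x.+1 by lia.
by case: (free_site s x.+1) => //=; lia.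
Qed.

(** The sites strictly between [v] and [m] become blocked, so the new count is constant there; this
    is the role of [minn]. *)
Lemma site_count_append_lt (x : nat) : v < m -> x < m -> A' x = A (minn x v).
Proof.
move=> lt_vm; elim: x => [|x IH] lt_x.
  rewrite min0n !site_count0 free_site_append // ltn0 subn0.
  by case: (free_site s 0) => //=; lia.
rewrite !site_countS IH ?(ltnW lt_x) // free_site_append; last by have := ltn_ord m; lia.
have -> : x.+1 - (m < x.+1) = x.+1 by lia.
case: (boolP (x.+1 <= v)) => [le_xv | lt_vx].
  have -> : minn x.+1 v = x.+1 by lia.
  have -> : minn x v = x by lia.
  rewrite site_countS; by case: (free_site s x.+1) => //=; lia.
have -> : minn x.+1 v = minn x v by lia.
by case: (free_site s x.+1) => //=; lia.
Qed.

Lemma site_count_append_self : v < m -> A' m = A v + 1.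
Proof.
move=> lt_vm; case em : (m : nat) => [|k]; first by lia.
rewrite site_countS site_count_append_lt; [|lia..].
have -> : minn k v = v by lia.
rewrite free_site_append -em; last by have := ltn_ord m; lia.
by rewrite ltnn subn0 m_free; lia.
Qed.

(** The truncated subtraction [A x - A v] is meant: it stays zero as long as [x <= v], over the
    sites that the descent blocks, and then counts the surviving shifted ones. *)
Lemma site_count_append_desc (x : nat) : m < v -> m <= x <= n.+1 ->
  A' x.+1 = A m + (A x - A v).
Proof.
move=> lt_mv /andP[].
elim: x => [|x IH] le_mx le_x.
  have em : m = 0 :> nat by lia.
  rewrite site_countS -{1}em site_count_append_le ?(ltnW lt_mv) //.
  rewrite free_site_append //.
  by have := leq_site_count s (leq0n v); lia.
rewrite site_countS.
case: (leqP m x) => [le_mx'|lt_xm]; last first.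
  have em : x.+1 = m by lia.
  rewrite em site_count_append_le ?(ltnW lt_mv) //.
  rewrite free_site_append; last by lia.
  by have := leq_site_count s (ltnW lt_mv); lia.
rewrite IH ?(ltnW le_x) // free_site_append; last by lia.
have -> : x.+2 - (m < x.+2) = x.+1 by lia.
have := site_countS s x.
case: (leqP x.+1 v) => h.
  have := leq_site_count s h; have := leq_site_count s (leqnSn x).
  by case: (free_site s x.+1) => /=; lia.
have : A v <= A x by apply: leq_site_count; lia.
by case: (free_site s x.+1) => /=; lia.
Qed.

(** Above [m] nothing is blocked; the [1] comes from the splitting of [m] into two free sites.
    Writing the identity additively avoids truncation and treats [m = v] and [m > v] together. *)
Lemma site_count_append_asc (x : nat) : v <= m -> m <= x <= n.+1 ->
  A' x.+1 + A m = A' m + 1 + A x.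
Proof.
move=> le_vm /andP[].
have base : A' m.+1 = A' m + 1.
  rewrite site_countS free_site_append; last by have := ltn_ord m; lia.
  have -> : m.+1 - (m < m.+1) = m by lia.
  by rewrite m_free; lia.
elim: x => [|x IH] le_mx le_x.
  have em : m = 0 :> nat by lia.
  by move: base; rewrite em; lia.
case: (leqP m x) => [le_mx'|lt_xm]; last first.
  have -> : x.+1 = m by lia.
  by rewrite base; lia.
rewrite site_countS (site_countS s x) free_site_append; last by lia.
have -> : x.+2 - (m < x.+2) = x.+1 by lia.
have := IH le_mx' (ltnW le_x).
by case: (free_site s x.+1) => /=; lia.
Qed.

Let v_free : free_site s v := free_site_last SBs.

(** The new label depends only on the new count at [m], now the last value, and at the top site
    [n.+2]. *)
Lemma label_append :
  (label (append_value s m) - label s =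
   if (m < v)%N then ((A m)%:Z - (A v)%:Z, 0)
   else if (v < m)%N then (1, (A v)%:Z + 1 - (A m)%:Z) else (0, 1))%R.
Proof.
have SB' : strong_Baxter (append_value s m) by rewrite strong_Baxter_append SBs.
rewrite !label_site_count // append_value_last.
have le_m : m <= n.+1 by have := ltn_ord m; lia.
have le_v : v <= n.+1 by rewrite ltnW.
have Av := leq_site_count s le_v.
have subE (a b c d : int) : ((a, b) - (c, d) = (a - c, b - d))%R by [].
rewrite subE.
case: (ltngtP m v) => h.
- have := site_count_append_le (ltnW h) (leqnn m).
  have := site_count_append_desc h (x := n.+1); rewrite le_m leqnn => /(_ isT).
  by move=> -> ->; congr pair; lia.
- have := site_count_append_asc (ltnW h) (x := n.+1); rewrite le_m leqnn => /(_ isT).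
  by rewrite site_count_append_self // => e; congr pair; lia.
- have := site_count_append_asc (eq_leq (esym h)) (x := n.+1); rewrite le_m leqnn => /(_ isT).
  have := site_count_append_le (eq_leq h) (leqnn m).
  by rewrite h => -> e; congr pair; lia.
Qed.

(** Since [v] and [m] are free, a value [u] below either has a strictly smaller count; this ties the
    signs tested by [coalescent_step] to the position of [u]. Coalescence happens between [v] and
    [m]: a descent sends the heights of the values [m <= u < v] to 0, an ascent those of positive
    height with [u < m] to -1. Other heights are shifted or kept. *)
Lemma coalescent_step_append (u : 'I_n.+1) :
  let d := (label (append_value s m) - label s)%R in
  coalescent_step ((A u)%:Z - (A v)%:Z)%R d.1 d.2 =
  ((A' (bump m u))%:Z - (A' m)%:Z)%R.
Proof.
rewrite label_append /bump /coalescent_step.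
have lt_u := ltn_ord u.
have mono := leq_site_count s; have smono := ltn_site_count (s := s).
case: (ltngtP m v) => h /=.
- have A'm := site_count_append_le (ltnW h) (leqnn m).
  have Amv := smono _ _ v_free h.
  case: (leqP m u) => hu.
    rewrite add1n site_count_append_desc ?hu ?(ltnW lt_u) // A'm.
    have := mono _ _ hu.
    by case: (leqP u v) => huv;
      [have := mono _ _ huv | have := mono _ _ (ltnW huv)];
      do ?case: ifP; lia.
  rewrite add0n site_count_append_le ?(ltnW h) ?(ltnW hu) // A'm.
  have := smono _ _ m_free hu; do ?case: ifP; lia.
- have A'm := site_count_append_self h.
  have Amv := smono _ _ m_free h.
  case: (leqP m u) => hu.
    have := site_count_append_asc (ltnW h) (x := u); rewrite hu (ltnW lt_u) => /(_ isT).
    rewrite add1n A'm; have := mono _ _ hu; do ?case: ifP; lia.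
  rewrite add0n site_count_append_lt // A'm.
  have := smono _ _ m_free hu.
  case: (leqP u v) => huv; first by have := mono _ _ huv; do ?case: ifP; lia.
  have := mono _ _ (ltnW huv); do ?case: ifP; lia.
- have A'm := site_count_append_le (eq_leq h) (leqnn m).
  case: (leqP m u) => hu.
    have := site_count_append_asc (eq_leq (esym h)) (x := u).
    rewrite hu (ltnW lt_u) => /(_ isT); rewrite add1n A'm.
    have := mono _ _ hu; rewrite h; do ?case: ifP; lia.
  rewrite add0n A'm site_count_append_le ?(eq_leq h) ?(ltnW hu) // h.
  have := smono _ _ m_free hu; rewrite h; do ?case: ifP; lia.
Qed.

End AppendCount.

(** * Coalescent walks of [PW s] and recovery of the order *)

Local Open Scope ring_scope.

Lemma nth_PW (n : nat) (s : 'S_n) (t : nat) (lt_tn : (t < n)%N) :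
  (PW s)`_t = label (prefix_pattern lt_tn s).
Proof.
rewrite -[t]/(val (Ordinal lt_tn)) -tnth_nth tnth_mktuple.
by congr (label (prefix_pattern _ s)); apply: bool_irrelevance.
Qed.

Lemma nth_PW_append (n : nat) (s : 'S_n) (m : 'I_n.+1) (t : nat) :
  (t < n)%N -> (PW (append_value s m))`_t = (PW s)`_t.
Proof.
move=> lt_tn; rewrite (nth_PW _ lt_tn) (nth_PW _ (leqW lt_tn)).
by rewrite (prefix_append lt_tn).
Qed.

Lemma nth_PW_last (n : nat) (s : 'S_n.+1) : (PW s)`_n = label s.
Proof. by rewrite (nth_PW _ (ltnSn n)) prefix_pattern_full. Qed.

Lemma coalescent_walkS (W : seq (int * int)) (t k : nat) :
  let d := W`_(t + k).+1 - W`_(t + k) in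
  coalescent_walk W t k.+1 = coalescent_step (coalescent_walk W t k) d.1 d.2.
Proof. by []. Qed.

Lemma eq_coalescent_walk (W W' : seq (int * int)) (t k : nat) :
  (forall l, (l <= t + k)%N -> W`_l = W'`_l) ->
  coalescent_walk W t k = coalescent_walk W' t k.
Proof.
elim: k => //= k IH eW; rewrite IH => [|l le_l]; last by apply: eW; lia.
by rewrite !eW // addnS // leqnSn.
Qed.

Lemma coalescent_walk_PW (n : nat) (s : 'S_n.+1) (t : 'I_n.+1) :
  strong_Baxter s ->
  coalescent_walk (PW s) t (n - t) =
  (site_count s (s t))%:Z - (site_count s (s ord_max))%:Z.
Proof.
elim: n s t => [|n IH] s t; first by rewrite !ord1 subrr.
rewrite (append_prefix s); move: (prefix_pattern _ s) (s ord_max) => {}s m.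
rewrite strong_Baxter_append => /andP[SBs m_free]; rewrite append_value_last.
case: (unliftP ord_max t) => [u|] ->; last by rewrite subnn append_value_last subrr.
have le_u : (u <= n)%N by rewrite -ltnS.
rewrite append_value_lift lift_max subSn // coalescent_walkS subnKC //.
(* Up to time [n] the walk reads only labels of prefixes that the appended value leaves
   unchanged. *)
rewrite (eq_coalescent_walk (W' := PW s)) => [|l le_l]; last first.
  by rewrite nth_PW_append // ltnS -[n in (_ <= n)%N](subnKC le_u).
by rewrite IH // (nth_PW_append s m (ltnSn n)) !nth_PW_last coalescent_step_append.
Qed.

(** Deleting final values reduces to the case where [j] is the last position. There [s j] is a free
    site, so a smaller value has a strictly smaller count, while a larger value may still have
    height 0. *)
Lemma WC_Sb_PW_lt0 (n : nat) (s : 'S_n) (i j : 'I_n) :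
  strong_Baxter s -> (i < j)%N -> (WC_Sb (PW s) i j < 0) = (s i < s j)%N.
Proof.
elim: n s i j => [|n IH] s i j; first by case: i.
rewrite (append_prefix s); move: (prefix_pattern _ s) (s ord_max) => {}s m SBsm.
have := SBsm; rewrite strong_Baxter_append => /andP[SBs m_free] lt_ij.
case: (unliftP ord_max j) lt_ij => [j'|] -> lt_ij.
  case: (unliftP ord_max i) lt_ij => [i'|] -> lt_ij; last first.
    by have := ltn_ord j'; rewrite lift_max /= in lt_ij *; lia.
  rewrite !lift_max in lt_ij; have <- : (s i' < s j')%N =
    (append_value s m (lift ord_max i') < append_value s m (lift ord_max j'))%N.
    by rewrite !append_value_lift /bump; lia.
  rewrite -IH // /WC_Sb !lift_max; congr (_ < _).
  apply: eq_coalescent_walk => l le_l; apply: nth_PW_append.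
  by apply: leq_ltn_trans (ltn_ord j'); rewrite -(subnKC (ltnW lt_ij)).
rewrite /WC_Sb coalescent_walk_PW // subr_lt0 ltz_nat.
case: (ltnP (append_value s m i)) => h.
  by apply: ltn_site_count h; apply: free_site_last.
by apply/negbTE; rewrite -leqNgt leq_site_count.
Qed.

Lemma CP_WC_Sb_PW (n : nat) (s : 'S_n) :
  strong_Baxter s -> CP (WC_Sb (PW s)) = Some s.
Proof.
move=> SBs.
have le_s i j : (s i <= s j)%N = le_Z (WC_Sb (PW s)) i j.
  rewrite /le_Z; case: (ltngtP i j) => [lt_ij|lt_ji|/val_inj ->].
  - by rewrite WC_Sb_PW_lt0 // leq_eqVlt perm_val_eq (ltn_eqF lt_ij).
  - by rewrite leNgt WC_Sb_PW_lt0 // -leqNgt.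
  - exact: leqnn.
rewrite /CP; case: pickP => [q /forallP q_le | /(_ s)/forallP[] i].
  congr Some; apply: perm_order_inj => i j.
  by rewrite !ltnNge; have /forallP/(_ i)/eqP -> := q_le j; rewrite le_s.
by apply/forallP => j; rewrite le_s.
Qed.

(** * The labels range exactly over the walks of [W_Sb] *)

Lemma strong_Baxter_S1 (s : 'S_1) : strong_Baxter s.
Proof. by apply/strong_BaxterP => i j j1 k; rewrite !ord1. Qed.

Lemma label_S1 (s : 'S_1) : label s = (0, 0).
Proof.
have free0 : free_site s 0 by apply/free_siteP => i j j1; rewrite !ord1.
rewrite label_site_count ?strong_Baxter_S1 // ord1.
by rewrite site_countS site_count0 free0 free_site_ge.
Qed.

Lemma label_ge0 (n : nat) (s : 'S_n.+1) :
  strong_Baxter s -> 0 <= (label s).1 /\ 0 <= (label s).2.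
Proof.
move=> SBs; rewrite label_site_count //=.
have := site_count_gt0 (free_site_last SBs).
have := ltn_site_count (free_site_ge s (leqnn _)) (ltn_ord (s ord_max)).
by split; lia.
Qed.

Lemma I_Sb_label_append (n : nat) (s : 'S_n.+1) (m : 'I_n.+2) :
  strong_Baxter s -> free_site s m ->
  I_Sb (label (append_value s m) - label s).
Proof.
move=> SBs m_free; rewrite label_append //.
case: (ltngtP m (s ord_max)) => h.
- apply: Or31; have := ltn_site_count (free_site_last SBs) h => lt_A.
  exists (site_count s (s ord_max) - site_count s m)%N; first by rewrite subn_gt0.
  by congr pair; lia.
- apply: Or33; have := ltn_site_count m_free h => lt_A.
  (* No truncation occurs: [m] is free and above the last value, so its count is strictly larger. *)
  exists (site_count s m - (site_count s (s ord_max)).+1)%N.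
  by congr pair; lia.
- exact: Or32.
Qed.

(** Each increment prescribes the count at [m], and nonnegativity of the target label puts that
    count between 1 and the total, where [site_count_ivt] supplies a free site. The increment
    [(0, 1)] takes the last value itself. *)
Lemma append_of_I_Sb (n : nat) (s : 'S_n.+1) (d : int * int) :
  strong_Baxter s -> I_Sb d ->
  0 <= (label s + d).1 -> 0 <= (label s + d).2 ->
  exists2 m : 'I_n.+2, free_site s m & label (append_value s m) = label s + d.
Proof.
move=> SBs Id; rewrite [in X in X -> _]label_site_count //.
rewrite [in X in _ -> X -> _]label_site_count //=.
set v := s ord_max => ge1 ge2.
have le_v : (v <= n.+1)%N by rewrite ltnW.
have le_Av := leq_site_count s le_v.
suff [m m_free <-] : exists2 m : 'I_n.+2, free_site s m &
    label (append_value s m) - label s = d.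
  by exists m => //; rewrite addrC subrK.
have site c : (0 < c <= site_count s n.+1)%N ->
    exists2 m : 'I_n.+2, free_site s m & site_count s m = c.
  by move=> /site_count_ivt[x [le_x hx ex]]; exists (Ordinal (le_x : (x < n.+2)%N)).
case: Id ge1 ge2 => [[i i_gt0 ->] | -> | [i ->]] /= ge1 ge2.
- have [|m m_free Am] := site (site_count s v - i)%N; first by lia.
  exists m => //; rewrite label_append // -/v.
  case: ltnP => h; first by congr pair; lia.
  by have := leq_site_count s h; lia.
- exists (Ordinal (le_v : (v < n.+2)%N)); first exact: free_site_last.
  by rewrite label_append //= -/v ?ltnn //; apply: free_site_last.
- have [|m m_free Am] := site (site_count s v + i.+1)%N; first by lia.
  exists m => //; rewrite label_append // -/v.
  case: (ltngtP m v) => h.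
  + by have := leq_site_count s (ltnW h); lia.
  + by congr pair; lia.
  + by move: Am; rewrite h; lia.
Qed.

Lemma W_Sb_PW (n : nat) (s : 'S_n.+1) : strong_Baxter s -> W_Sb (PW s).
Proof.
elim: n s => [|n IH] s.
  move=> SBs; split=> [|[]|[]] //=; rewrite nth_PW_last ?label_S1 //.
rewrite (append_prefix s); move: (prefix_pattern _ s) (s ord_max) => {}s m SBsm.
have := SBsm; rewrite strong_Baxter_append => /andP[SBs m_free].
have [W0 W_ge0 W_inc] := IH s SBs; split=> [|t|t].
- by rewrite nth_PW_append.
- rewrite ltnS leq_eqVlt => /orP[/eqP -> | lt_t].
    by rewrite nth_PW_last; apply: label_ge0.
  by rewrite nth_PW_append //; apply: W_ge0.
- rewrite ltnS leq_eqVlt => /orP[/eqP[->] | lt_t].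
    by rewrite nth_PW_last (nth_PW_append s m (ltnSn n)) nth_PW_last; apply: I_Sb_label_append.
  rewrite (nth_PW_append s m lt_t) (nth_PW_append s m (ltnW lt_t)).
  exact: W_inc.
Qed.

(** Here [W] is a plain sequence read up to index [n], so the induction shortens the walk without
    truncating a tuple. *)
Lemma PW_surj (n : nat) (W : seq (int * int)) :
  W`_0 = (0, 0) ->
  (forall t, (t < n.+1)%N -> 0 <= (W`_t).1 /\ 0 <= (W`_t).2) ->
  (forall t, (t.+1 < n.+1)%N -> I_Sb (W`_t.+1 - W`_t)) ->
  exists2 s : 'S_n.+1, strong_Baxter s &
    forall t, (t < n.+1)%N -> (PW s)`_t = W`_t.
Proof.
move=> W0; elim: n => [|n IH] W_ge0 W_inc.
  exists 1%g; first exact: strong_Baxter_S1.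
  by case=> // _; rewrite nth_PW_last label_S1.
have [t lt_t | t lt_t | s SBs eW] := IH.
- exact/W_ge0/ltnW.
- exact/W_inc/ltnW.
have label_s : label s = W`_n by rewrite -nth_PW_last eW.
have [ge1 ge2] := W_ge0 n.+1 (ltnSn _).
have label_d : label s + (W`_n.+1 - W`_n) = W`_n.+1.
  by rewrite label_s addrC subrK.
have := append_of_I_Sb SBs (W_inc n (ltnSn _)); rewrite label_d.
move=> /(_ ge1 ge2)[m m_free label_m].
exists (append_value s m); first by rewrite strong_Baxter_append SBs.
move=> t; rewrite ltnS leq_eqVlt => /orP[/eqP -> | lt_t].
  by rewrite nth_PW_last label_m.
by rewrite nth_PW_append // eW.
Qed.

Local Close Scope ring_scope.

Theorem theorem3p10 (n : nat) :
  [/\ forall s : 'S_n.+1, strong_Baxter s -> W_Sb (PW s),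
      forall W : n.+1.-tuple (int * int), W_Sb W ->
        exists s : 'S_n.+1,
          [/\ CP (WC_Sb W) = Some s, strong_Baxter s & PW s = W] &
      forall s : 'S_n.+1, strong_Baxter s -> CP (WC_Sb (PW s)) = Some s].
Proof.
split=> [s | W [W0 W_ge0 W_inc] | s]; [exact: W_Sb_PW | | exact: CP_WC_Sb_PW].
have [s SBs eW] := PW_surj W0 W_ge0 W_inc.
have PW_s : PW s = W.
  by apply: eq_from_tnth => t; rewrite !(tnth_nth 0%R) eW.
by exists s; split; rewrite -?PW_s //; apply: CP_WC_Sb_PW.
Qed.
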